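(* Let $\alpha\in\mathbb{C}^\times$ and let $A_\alpha=\mathbb{C}x\oplus\mathbb{C}y$ be the two-dimensional left-symmetric color algebra described in the context. For $c\in G$ let $\mathcal{N}_c(A_\alpha)$ be the set of Nijenhuis operators on $A_\alpha$ of degree $c$, and let $\mathcal{N}(A_\alpha)=\bigoplus_{c\in G}\mathcal{N}_c(A_\alpha)$ be the space of all sums of such operators. Then, by taking matrices relative to the basis $x,y$ (the columns being the coordinates of $P(x)$ and $P(y)$), the space $\mathcal{N}(A_\alpha)$ is isomorphic to the matrix space $$\left\{\begin{pmatrix} r&0\\ s&r\end{pmatrix}\;\middle|\; r,s\in\mathbb{C}\right\}.$$
   Context: $G$ is a finite abelian group, written additively. A bicharacter of $G$ over $\mathbb{C}$ is a map $\epsilon:G\times G\to\mathbb{C}^\times$ that is multiplicative in each variable; it is skew-symmetric if $\epsilon(a,b)\epsilon(b,a)=1$. Fix a skew-symmetric bicharacter $\epsilon$. A left-symmetric color algebra over $\mathbb{C}$ with respect to $\epsilon$ is a $G$-graded nonassociative $\mathbb{C}$-algebra with $(uv)w-u(vw)=\epsilon(|u|,|v|)\big((vu)w-v(uw)\big)$ for all homogeneous $u,v,w$, where $|u|$ is the degree of $u$. $A_\alpha=\mathbb{C}x\oplus\mathbb{C}y$ has unique nonzero product of basis elements $x^2=\alpha y$, with $x,y$ homogeneous, $2|x|=|y|$, $|x|\neq|y|$, and both $|x|$ and $|y|$ nonzero in $G$. A homogeneous linear map $P$ of degree $|P|\in G$ on a left-symmetric color algebra is a Nijenhuis operator if $$P(u)P(v)=\epsilon(|P|+|u|,|P|)P\big(P(u)v\big)+P\big(uP(v)\big)-\epsilon(|u|,|P|)P\big(P(uv)\big)$$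 for all homogeneous $u,v$. *)

(* Defs.v *)
From HB Require Import structures.
From mathcomp Require Import all_boot all_order all_algebra.
From mathcomp Require Import boolp classical_sets functions reals complex.

Set Implicit Arguments.
Unset Strict Implicit.
Unset Printing Implicit Defensive.

Import GRing.Theory.

Local Open Scope ring_scope.
Local Open Scope classical_set_scope.

(* Bicharacters take values in F^x: a function into F with no zero value. *)
Record skew_bicharacter (G : finZmodType) (F : fieldType) := SkewBicharacter {
  bichar :> G -> G -> F;
  bichar_neq0 : forall a b, bichar a b != 0;
  bicharDl : forall a b c, bichar (a + b) c = bichar a c * bichar b c;
  bicharDr : forall a b c, bichar a (b + c) = bichar a b * bichar a c;
  bichar_skew : forall a b, bichar a b * bichar b a = 1 }.

(* The zero vector belongs to every component; quantifying over pairs         *)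
(* (g, u) with u \in comp g therefore ranges over the homogeneous vectors     *)
(* together with their degree, and only adds trivial instances at u = 0.      *)
Record lscolor_algebra (G : finZmodType) (F : fieldType)
    (eps : skew_bicharacter G F) := LSColorAlgebra {
  carrier :> vectType F;
  lsmul : carrier -> carrier -> carrier;
  lsmul_linearl : forall v, linear (lsmul^~ v);
  lsmul_linearr : forall u, linear (lsmul u);
  comp : G -> {vspace carrier};
  comp_direct : directv (\sum_(g : G) comp g);
  comp_full : (\sum_(g : G) comp g)%VS = fullv;
  lsmul_graded : forall a b u v,
    u \in comp a -> v \in comp b -> lsmul u v \in comp (a + b);
  lsmul_left_symmetric : forall a b c u v w,
    u \in comp a -> v \in comp b -> w \in comp c ->
    lsmul (lsmul u v) w - lsmul u (lsmul v w)
    = eps a b *: (lsmul (lsmul v u) w - lsmul v (lsmul u w)) }.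

Section Nijenhuis.
Variables (G : finZmodType) (F : fieldType) (eps : skew_bicharacter G F).
Variable A : lscolor_algebra eps.
Implicit Types (P : 'End(A)) (c : G).

Definition homogeneous_map c P : Prop :=
  forall g u, u \in comp A g -> P u \in comp A (g + c).

Definition nijenhuis c : set 'End(A) :=
  [set P | homogeneous_map c P /\
    forall a b u v, u \in comp A a -> v \in comp A b ->
      lsmul (P u) (P v)
      = eps (c + a) c *: P (lsmul (P u) v) + P (lsmul u (P v))
        - eps a c *: P (P (lsmul u v))].

Definition nijenhuis_space : set 'End(A) :=
  [set P | exists Q : G -> 'End(A),
     (forall c, nijenhuis c (Q c)) /\ P = \sum_(c : G) Q c].

(* The sum over c is direct. *)
Lemma homogeneous_sum_unique (Q Q' : G -> 'End(A)) :
  (forall c, homogeneous_map c (Q c)) -> (forall c, homogeneous_map c (Q' c)) ->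
  \sum_(c : G) Q c = \sum_(c : G) Q' c -> forall c, Q c = Q' c.
Proof.
move=> hQ hQ' eQ c; apply/lfunP => v.
have /memv_sumP[vs vsP ->] : v \in (\sum_(g : G) comp A g)%VS.
  by rewrite comp_full memvf.
rewrite !linear_sum; apply: eq_bigr => g _.
have shift (S : G -> 'End(A)) :
    \sum_(h : G) S (h - g) (vs g) = (\sum_(d : G) S d) (vs g).
  rewrite sum_lfunE (reindex_inj (addIr g)) /=.
  by apply: eq_bigr => d _; rewrite addrK.
have inD S : (forall d, homogeneous_map d (S d)) ->
    forall h, xpredT h -> S (h - g) (vs g) \in comp A h.
  by move=> hS h _; have := hS (h - g) g _ (vsP g isT); rewrite [g + _]addrC subrK.
have /directv_sum_unique uniqA := comp_direct A.
have /esym := uniqA _ _ (inD _ hQ) (inD _ hQ').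
rewrite !shift eQ eqxx => /forall_inP/(_ (c + g) isT)/eqP.
by rewrite addrK.
Qed.

Record is_A_alpha (alpha : F) (x y : A) (dx dy : G) : Prop := IsAAlpha {
  A_basis : basis_of fullv [tuple x; y];
  A_xhom : x \in comp A dx;
  A_yhom : y \in comp A dy;
  A_deg2 : dx *+ 2 = dy;
  A_degneq : dx <> dy;
  A_degx : dx <> 0;
  A_degy : dy <> 0;
  A_xx : lsmul x x = alpha *: y;
  A_xy : lsmul x y = 0;
  A_yx : lsmul y x = 0;
  A_yy : lsmul y y = 0 }.

(* Unlike the library's mxof, which acts on row vectors, the images of the    *)
(* basis vectors are the columns here.                                        *)
Definition col_matrix (x y : A) (P : 'End(A)) : 'M[F]_2 :=
  let e := [tuple x; y] in \matrix_(i < 2, j < 2) coord e i (P (tnth e j)).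

End Nijenhuis.
Arguments nijenhuis {G F eps} A c _.
Arguments nijenhuis_space {G F eps} A _.

Definition is_subspace (F : fieldType) (U : lmodType F) (S : set U) : Prop :=
  S 0 /\ forall k u v, S u -> S v -> S (k *: u + v).

Definition linear_iso_between (F : fieldType) (U V : lmodType F)
    (S : set U) (T : set V) (f : U -> V) : Prop :=
  [/\ is_subspace S, is_subspace T,
      forall k u v, S u -> S v -> f (k *: u + v) = k *: f u + f v
    & set_bij S T f].

Definition rs_matrix (F : fieldType) (r s : F) : 'M[F]_2 :=
  \matrix_(i < 2, j < 2) (nth [::] [:: [:: r; 0]; [:: s; r]] i)`_j.

Definition rs_matrices (F : fieldType) : set 'M[F]_2 :=
  [set M | exists r s, M = rs_matrix r s].
Arguments rs_matrices F : clear implicits.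

(* Main.v *)
From HB Require Import structures.
Require Import Defs.
From mathcomp Require Import all_boot all_order all_algebra.
From mathcomp Require Import boolp classical_sets functions reals complex.
From mathcomp Require Import ring.

(** Write g for the degree of x, so that y has degree 2g and the degrees 0, g
    and 2g are pairwise distinct.  The only nonzero components of the algebra
    are the lines of x and y, hence a map P of degree c with
    P x = k x + l y and P y = m x + n y has k = n = 0 unless c = 0.  Two
    instances of the Nijenhuis identity finish the description:
    - at (y, y) every term but P y * P y = m^2 alpha y vanishes, so m = 0;
    - at (x, x) in degree 0 it reads k^2 = 2 k n - n^2, so k = n.
    Thus a homogeneous Nijenhuis operator, and so any sum of such operators,
    sends x to r x + s y and y to r y ([nijenhuis_rs_form]).

    Conversely such a map is r times the identity, a Nijenhuis operator of
    degree 0 in every algebra ([nijenhuis_scale_id]), plus the map x |-> s y,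
    y |-> 0, which has degree g and for which all terms of the identity vanish
    because y annihilates the algebra on both sides and the map squares to zero
    ([nijenhuis_nilpotent]).  Hence the Nijenhuis space consists of exactly the
    maps of this form ([nijenhuis_spaceP]), and these are the maps with a
    matrix in the required space. *)

Set Implicit Arguments.
Unset Strict Implicit.
Unset Printing Implicit Defensive.

Import GRing.Theory.

Local Open Scope ring_scope.
Local Open Scope classical_set_scope.

(** * Operators on an arbitrary left-symmetric color algebra *)

Section ColorAlgebra.
Variables (G : finZmodType) (F : fieldType) (eps : skew_bicharacter G F).
Variable A : lscolor_algebra eps.

Lemma lsmulDl (u v w : A) : lsmul (u + v) w = lsmul u w + lsmul v w.
Proof. by have := lsmul_linearl w 1 u v; rewrite !scale1r. Qed.

Lemma lsmulDr (u v w : A) : lsmul u (v + w) = lsmul u v + lsmul u w.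
Proof. by have := lsmul_linearr u 1 v w; rewrite !scale1r. Qed.

Lemma lsmul0l (w : A) : lsmul 0 w = 0.
Proof. by apply: (addrI (lsmul 0 w)); rewrite -lsmulDl !addr0. Qed.

Lemma lsmul0r (w : A) : lsmul w 0 = 0.
Proof. by apply: (addrI (lsmul w 0)); rewrite -lsmulDr !addr0. Qed.

Lemma lsmulZl k (u w : A) : lsmul (k *: u) w = k *: lsmul u w.
Proof. by have := lsmul_linearl w k u 0; rewrite !addr0 lsmul0l addr0. Qed.

Lemma lsmulZr k (u w : A) : lsmul u (k *: w) = k *: lsmul u w.
Proof. by have := lsmul_linearr u k w 0; rewrite !addr0 lsmul0r addr0. Qed.

Lemma bichar0r a : eps a 0 = 1.
Proof.
by apply: (mulfI (bichar_neq0 eps a 0)); rewrite -bicharDr addr0 mulr1.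
Qed.

Lemma nijenhuis0 c : nijenhuis A c 0.
Proof.
split=> [g u _|a b u v _ _]; first by rewrite lfunE mem0v.
by rewrite !zero_lfunE lsmul0l !scaler0 addr0 subr0.
Qed.

Lemma nijenhuis_scale_id r : nijenhuis A 0 (r *: \1%VF).
Proof.
split=> [g u gu|a b u v _ _]; first by rewrite addr0 scale_lfunE id_lfunE memvZ.
rewrite add0r !bichar0r !scale1r !(scale_lfunE, id_lfunE) !lsmulZl !lsmulZr.
by rewrite addrK.
Qed.

End ColorAlgebra.

(** * The algebra spanned by x and y *)

Section AAlpha.
Variables (G : finZmodType) (F : fieldType) (eps : skew_bicharacter G F).
Variable A : lscolor_algebra eps.
Variables (alpha : F) (x y : A) (dx dy : G).
Hypothesis hA : is_A_alpha alpha x y dx dy.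

Let e := [tuple x; y].

Lemma A_expand (v : A) : v = coord e 0 v *: x + coord e 1 v *: y.
Proof.
rewrite {1}(coord_basis (A_basis hA) (memvf v)) big_ord_recl big_ord1 /=.
by congr (_ + coord e _ v *: y); apply: val_inj.
Qed.

Lemma coordA a b :
  coord e 0 (a *: x + b *: y) = a /\ coord e 1 (a *: x + b *: y) = b.
Proof.
have fe : free e := basis_free (A_basis hA).
have c0 i := coord_free 0 i fe; have c1 i := coord_free 1 i fe.
rewrite !linearD !linearZ /= [coord e 0 x]c0 [coord e 0 y](coord_free 1 0 fe).
rewrite [coord e 1 x](coord_free 0 1 fe) [coord e 1 y](coord_free 1 1 fe) /=.
by rewrite !mulr1 !mulr0 addr0 add0r.
Qed.

Lemma A_indep a b a' b' :
  a *: x + b *: y = a' *: x + b' *: y -> a = a' /\ b = b'.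
Proof.
by move=> E; have := coordA a b; rewrite E; case: (coordA a' b') => -> -> [].
Qed.

Lemma A_lfunP (P Q : 'End(A)) : P x = Q x -> P y = Q y -> P = Q.
Proof.
by move=> Px Py; apply/lfunP=> v; rewrite (A_expand v) !linearP !linearZ /= Px Py.
Qed.

Lemma lsmul_yl v : lsmul y v = 0.
Proof.
by rewrite (A_expand v) lsmulDr !lsmulZr (A_yx hA) (A_yy hA) !scaler0 addr0.
Qed.

Lemma lsmul_yr v : lsmul v y = 0.
Proof.
by rewrite (A_expand v) lsmulDl !lsmulZl (A_xy hA) (A_yy hA) !scaler0 addr0.
Qed.

(** The components form a direct sum, so the x-part of a vector of degree a
    can survive only in degree dx, and its y-part only in degree dy. *)
Lemma comp_coords {a u} : u \in Defs.comp A a ->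
  exists k l, [/\ u = k *: x + l *: y, a <> dx -> k = 0 & a <> dy -> l = 0].
Proof.
move=> au; set k := coord e 0 u; set l := coord e 1 u; exists k, l.
(* The degree-h part of u - k x - l y, a vector that is zero. *)
pose us h := (if h == a then u else 0) - (if h == dx then k *: x else 0)
             - (if h == dy then l *: y else 0).
have usP h : true -> us h \in Defs.comp A h.
  move=> _; rewrite /us; apply: memvB; first apply: memvB.
  - by case: eqP => [->|] //; rewrite mem0v.
  - by case: eqP => [->|] //; rewrite ?mem0v // memvZ // (A_xhom hA).
  - by case: eqP => [->|] //; rewrite ?mem0v // memvZ // (A_yhom hA).
have us0 : \sum_h us h = 0.
  rewrite !sumrB -!big_mkcond !big_pred1_eq {1}(A_expand u) -/k -/l.
  by rewrite addrAC addrK subrr.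
have /directv_sum_independent/(_ us usP us0) us_eq0 := comp_direct A.
have /eqP dxy := A_degneq hA.
split=> [|adx|ady]; first exact: A_expand.
- have := us_eq0 dx isT; rewrite /us eqxx (negPf dxy) subr0.
  case: eqP => [/esym//|_ /eqP]; rewrite sub0r oppr_eq0 => /eqP kx0.
  have [] // := @A_indep k 0 0 0.
  by rewrite kx0 !scale0r addr0.
- have := us_eq0 dy isT; rewrite /us eqxx eq_sym in dxy *.
  rewrite (negPf dxy) subr0.
  case: eqP => [/esym//|_ /eqP]; rewrite sub0r oppr_eq0 => /eqP ly0.
  have [] // := @A_indep 0 l 0 0.
  by rewrite ly0 !scale0r addr0.
Qed.

Definition rs_form r s (P : 'End(A)) : Prop :=
  P x = r *: x + s *: y /\ P y = r *: y.

Lemma rs_form_lin {k r s r' s' P Q} : rs_form r s P -> rs_form r' s' Q ->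
  rs_form (k * r + r') (k * s + s') (k *: P + Q).
Proof.
move=> [Px Py] [Qx Qy]; split; rewrite add_lfunE scale_lfunE ?Px ?Py ?Qx ?Qy.
  by rewrite !scalerDl scalerDr !scalerA addrACA.
by rewrite scalerDl scalerA.
Qed.

Lemma rs_form_sum (Q : G -> 'End(A)) :
  (forall c, exists r s, rs_form r s (Q c)) ->
  exists r s, rs_form r s (\sum_c Q c).
Proof.
move=> hQ; apply: (big_ind (fun P => exists r s, rs_form r s P)) => //.
  by exists 0, 0; split; rewrite zero_lfunE !scale0r ?addr0.
move=> P P' [r [s hP]] [r' [s' hP']]; rewrite -[P]scale1r.
by do 2!eexists; apply: rs_form_lin hP hP'.
Qed.

Lemma exists_rs_form r s : exists P, rs_form r s P.
Proof.
pose f (v : A) := r *: v + (coord e 0 v * s) *: y.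
have f_lin : linear f.
  move=> k u v; rewrite /f [coord e 0 _]linearP /= mulrDl !scalerDl !scalerDr !scalerA.
  by rewrite addrACA mulrC -mulrA.
pose fL := GRing.isLinear.Build F A A *:%R f f_lin.
pose fl : {linear A -> A} := HB.pack f fL.
exists (linfun fl).
have [cx _] := coordA 1 0; have [cy _] := coordA 0 1.
rewrite !scale0r ?scale1r ?addr0 ?add0r in cx cy.
by split; rewrite lfunE /= /f ?cx ?cy ?mul1r // mul0r scale0r addr0.
Qed.

(** Degrees alone leave three kinds of homogeneous maps: diagonal ones (c = 0),
    x |-> s y (c = dx) and y |-> m x (c = - dx).  The identity at (y, y) removes
    the last kind, and at (x, x) it makes the diagonal ones scalar. *)
Lemma nijenhuis_rs_form c P : alpha != 0 -> nijenhuis A c P ->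
  exists r s, rs_form r s P.
Proof.
move=> alpha0 [homP nijP].
have [k [l [Px kE _]]] := comp_coords (homP _ _ (A_xhom hA)).
have [m [n [Py _ nE]]] := comp_coords (homP _ _ (A_yhom hA)).
have nijx := nijP _ _ _ _ (A_xhom hA) (A_xhom hA).
have nijy := nijP _ _ _ _ (A_yhom hA) (A_yhom hA).
have y0 b : b *: y = 0 -> b = 0.
  by move=> by0; have [] // := @A_indep 0 b 0 0; rewrite by0 !scale0r addr0.
have sqr0 z : alpha * (z * z) = 0 -> z = 0.
  by move/eqP; rewrite !mulf_eq0 (negPf alpha0) /= orbb => /eqP.
have m0 : m = 0.
  apply: sqr0; apply: y0; move: nijy.
  rewrite Py !(lsmulDl, lsmulDr, lsmulZl, lsmulZr) !lsmul_yl !lsmul_yr (A_xx hA).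
  by rewrite !(scaler0, linear0, addr0, subr0) !scalerA [alpha * _]mulrC.
rewrite m0 scale0r add0r in Py.
suff kn : k = n by exists k, l; split=> //; rewrite kn.
have [c0|/eqP c0] := eqVneq c 0; last first.
  have cneq (d : G) : d + c <> d.
    by rewrite -[RHS]addr0 => /addrI.
  by rewrite kE ?nE //; apply: cneq.
apply/eqP; rewrite -subr_eq0; apply/eqP/sqr0/y0.
move: nijx; rewrite c0 !bichar0r !scale1r Px.
rewrite !(lsmulDl, lsmulDr, lsmulZl, lsmulZr) !lsmul_yl !lsmul_yr (A_xx hA).
rewrite !scaler0 !addr0 !linearZ /= Py !linearZ /= Py scaler0 addr0.
rewrite !scalerN !scalerA -!scaleNr -!scalerDl => /eqP; rewrite -subr_eq0 -scalerBl => /eqP nij0.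
rewrite -[RHS]nij0; congr (_ *: y).
by ring.
Qed.

(** N takes its values in the line of y, which annihilates the algebra and is
    killed by N: every term of the Nijenhuis identity is zero. *)
Lemma nijenhuis_nilpotent s N : rs_form 0 s N -> nijenhuis A dx N.
Proof.
rewrite /rs_form !scale0r add0r => -[Nx Ny].
have NE u : exists b, N u = b *: y.
  exists (coord e 0 u * s); rewrite {1}(A_expand u) linearD !linearZ /= Nx Ny.
  by rewrite scaler0 addr0 scalerA.
have NN b : N (b *: y) = 0 by rewrite linearZ /= Ny scaler0.
split=> [g u gu|a b u v _ _].
- have [k [l [-> kE _]]] := comp_coords gu.
  rewrite linearD !linearZ /= Nx Ny scaler0 addr0 scalerA.
  have [->|/eqP /kE->] := eqVneq g dx; last by rewrite mul0r scale0r mem0v.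
  by rewrite -mulr2n (A_deg2 hA) memvZ // (A_yhom hA).
- have [i ->] := NE u; have [j ->] := NE v; have [k ->] := NE (lsmul u v).
  rewrite !(lsmulZl, lsmulZr) !lsmul_yl lsmul_yr !scaler0 !linear0.
  by rewrite NN !scaler0 addr0 subr0.
Qed.

Lemma nijenhuis_spaceP P : alpha != 0 ->
  nijenhuis_space A P <-> exists r s, rs_form r s P.
Proof.
move=> alpha0; split=> [[Q [QN ->]]|[r [s hP]]].
  by apply: rs_form_sum => c; apply: nijenhuis_rs_form (QN c).
pose N := (- r) *: \1%VF + P.
have N_form : rs_form 0 s N.
  have id_form : rs_form 1 0 (\1%VF : 'End(A)).
    by split; rewrite id_lfunE !scale1r ?scale0r ?addr0.
  have := rs_form_lin (k := - r) id_form hP.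
  by rewrite mulr1 addNr mulr0 add0r.
have /eqP dx0 := A_degx hA.
(* As dx is nonzero, the two summands occupy different degrees. *)
exists (fun c => if c == 0 then r *: \1%VF else if c == dx then N else 0).
split=> [c|].
  case: eqP => [->|_]; first exact: nijenhuis_scale_id.
  by case: eqP => [->|_]; [apply: nijenhuis_nilpotent N_form|apply: nijenhuis0].
rewrite (bigD1 0) //= eqxx (bigD1 dx) //= (negPf dx0) eqxx big1 => [|c].
  by rewrite addr0 addrA scaleNr subrr add0r.
by move=> /andP[/negPf-> /negPf->].
Qed.

Lemma rs_matrix_inj (r s r' s' : F) :
  rs_matrix r s = rs_matrix r' s' -> r = r' /\ s = s'.
Proof.
by move=> /matrixP E; have := E 0 0; have := E 1 0; rewrite !mxE.
Qed.

Lemma rs_matrix_lin (k r s r' s' : F) :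
  k *: rs_matrix r s + rs_matrix r' s' = rs_matrix (k * r + r') (k * s + s').
Proof.
apply/matrixP=> i j; rewrite !mxE.
by case: i j => [[|[|]]] // ? [[|[|]]] //= ?; rewrite mulr0 addr0.
Qed.

Lemma col_matrix_lin k (P Q : 'End(A)) :
  col_matrix x y (k *: P + Q) = k *: col_matrix x y P + col_matrix x y Q.
Proof. by apply/matrixP=> i j; rewrite !mxE add_lfunE scale_lfunE linearP. Qed.

Lemma col_matrix_rs_form {r s P} :
  rs_form r s P -> col_matrix x y P = rs_matrix r s.
Proof.
move=> [Px Py]; apply/matrixP=> i j; rewrite !mxE.
have [x0 x1] := coordA r s; have [y0 y1] := coordA 0 r.
rewrite scale0r add0r in y0 y1.
case: i j => [[|[|]]] // hi [[|[|]]] //= hj; rewrite (tnth_nth 0) /= ?Px ?Py.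
- by rewrite -[RHS]x0; congr (coord e _ _); apply: val_inj.
- by rewrite -[RHS]y0; congr (coord e _ _); apply: val_inj.
- by rewrite -[RHS]x1; congr (coord e _ _); apply: val_inj.
- by rewrite -[RHS]y1; congr (coord e _ _); apply: val_inj.
Qed.

Lemma nijenhuis_space_iso : alpha != 0 ->
  linear_iso_between (nijenhuis_space A) (rs_matrices F) (col_matrix x y).
Proof.
move=> alpha0; have spaceP P := nijenhuis_spaceP P alpha0.
split.
- split=> [|k P Q /spaceP[r [s hP]] /spaceP[r' [s' hQ]]]; apply/spaceP.
    by exists 0, 0; split; rewrite zero_lfunE !scale0r ?addr0.
  by do 2!eexists; apply: rs_form_lin hP hQ.
- split=> [|k _ _ [r [s ->]] [r' [s' ->]]].
    exists 0, 0; apply/matrixP=> i j; rewrite !mxE.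
    by case: i j => [[|[|]]] // ? [[|[|]]].
  by rewrite rs_matrix_lin; do 2!eexists.
- by move=> k P Q _ _; apply: col_matrix_lin.
- split.
  + move=> P /spaceP[r [s hP]] /=; exists r, s; exact: col_matrix_rs_form hP.
  + move=> P Q /set_mem/spaceP[r [s hP]] /set_mem/spaceP[r' [s' hQ]].
    rewrite (col_matrix_rs_form hP) (col_matrix_rs_form hQ) => /rs_matrix_inj[].
    case: hP hQ => [Px Py] [Qx Qy] rr ss.
    by apply: A_lfunP; rewrite ?Px ?Py ?Qx ?Qy rr ?ss.
  + move=> _ [r [s ->]]; have [P hP] := exists_rs_form r s.
    exists P; last exact: col_matrix_rs_form hP.
    by apply/spaceP; exists r, s.
Qed.

End AAlpha.

Theorem proposition4p12 (R : realType) (G : finZmodType)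
  (eps : skew_bicharacter G R[i]) (A : lscolor_algebra eps)
  (alpha : R[i]) (x y : A) (dx dy : G)
  (halpha : alpha != 0) (hA : is_A_alpha alpha x y dx dy) :
  linear_iso_between (nijenhuis_space A) (rs_matrices R[i]) (col_matrix x y).
Proof. exact: nijenhuis_space_iso hA halpha. Qed.
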